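(* Let $C$ be an arbitrary group. Then the following statements are equivalent. (i) The direct product $L \times C$ possesses the Magnus property for some limit group $L$ with the Magnus property. (ii) All groups $\big(\prod_{i\in\mathcal{I}} L_i\big)\times C$, where $\mathcal{I}\subset\mathbb{N}$ is an index set and the $L_i$ ($i\in\mathcal{I}$) are limit groups with the Magnus property, possess the Magnus property.
   Context: A group $G$ possesses the Magnus property if for every two elements $u,v\in G$ with the same normal closure in $G$, $u$ is conjugate in $G$ to $v$ or to $v^{-1}$. Limit groups are meant in the sense of Sela; they are taken to be indicable (a group is indicable if it admits an epimorphism onto $\mathbb{Z}$) and locally indicable (every non-trivial finitely generated subgroup is indicable). $\prod_{i\in\mathcal{I}} L_i$ denotes the direct product of the groups $L_i$. *)

(* Defs.v *)
From HB Require Import structures.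
From mathcomp Require Import all_boot all_order all_algebra.
From mathcomp Require Import all_classical.

Set Implicit Arguments.
Unset Strict Implicit.
Unset Printing Implicit Defensive.

Local Open Scope classical_set_scope.
Local Open Scope group_scope.

Section Subgroups.
Variable G : groupType.
Implicit Types (A H S : set G) (u v : G).

Definition is_subgroup H : Prop :=
  H 1 /\ forall x y, H x -> H y -> H (x / y).

Definition is_normal_subgroup H : Prop :=
  is_subgroup H /\ forall x g, H x -> H (x ^ g).

Definition subgroup_gen S : set G := smallest is_subgroup S.

Definition normal_closure u : set G := smallest is_normal_subgroup [set u].

Definition finitely_generated_subgroup H : Prop :=
  exists2 S : set G, finite_set S & H = subgroup_gen S.

Definition conjugate u v : Prop := exists g : G, u = v ^ g.

(* The subgroup H admits an epimorphism onto Z.  The epimorphism is given by a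
   function on G of which only the values on H matter. *)
Definition indicable_subgroup H : Prop :=
  exists f : G -> int,
    (forall x y, H x -> H y -> f (x * y) = (f x + f y)%R) /\
    set_surj H [set: int] f.

End Subgroups.

Section GroupProperties.
Variable G : groupType.

Definition finitely_generated : Prop := finitely_generated_subgroup [set: G].

Definition magnus_property : Prop :=
  forall u v : G, normal_closure u = normal_closure v ->
    conjugate u v \/ conjugate u v^-1.

Definition indicable : Prop := indicable_subgroup [set: G].

Definition locally_indicable : Prop :=
  forall H : set G, finitely_generated_subgroup H -> H <> [set 1] ->
    indicable_subgroup H.

End GroupProperties.

Definition free_basis (X : Type) (F : groupType) (e : X -> F) : Prop :=
  forall (H : groupType) (f : X -> H),
    exists phi : {multiplicative F -> H},
      (forall i, phi (e i) = f i) /\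
      forall psi : {multiplicative F -> H},
        (forall i, psi (e i) = f i) -> psi =1 phi.

Section StableSequences.
Variables (G F : groupType) (h : nat -> {multiplicative G -> F}).

Definition stable_kernel : set G := [set g | \forall n \near \oo, h n g = 1].

Definition stable_sequence : Prop :=
  forall g : G, (\forall n \near \oo, h n g = 1) \/
                (\forall n \near \oo, h n g <> 1).

End StableSequences.

(* Sela's limit groups, in the formulation of Bestvina and Feighn: L is
   isomorphic to the quotient of a finitely generated group G by the stable
   kernel of a stable sequence of homomorphisms from G to a free group F of
   finite rank k. The isomorphism is given as an epimorphism p from G to L with
   that kernel. *)
Definition sela_limit_group (L : groupType) : Prop :=
  exists (k : nat) (F G : groupType) (e : 'I_k -> F)
         (h : nat -> {multiplicative G -> F}) (p : {multiplicative G -> L}),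
    [/\ free_basis e, finitely_generated G, stable_sequence h,
        set_surj [set: G] [set: L] p &
        [set g | p g = 1] = stable_kernel h].

(* Limit groups are understood to be indicable and locally indicable. For a
   group satisfying sela_limit_group this excludes exactly the trivial group. *)
Definition limit_group (L : groupType) : Prop :=
  [/\ sela_limit_group L, indicable L & locally_indicable L].

Definition prodg (I : Type) (L : I -> groupType) : Type := forall i : I, L i.

Section DirectProduct.
Variables (I : Type) (L : I -> groupType).

HB.instance Definition _ := Choice.copy (prodg L) (forall i : I, L i).

Let one : prodg L := fun=> 1.
Let inv (f : prodg L) : prodg L := fun i => (f i)^-1.
Let mul (f g : prodg L) : prodg L := fun i => f i * g i.

Let mulA : associative mul.
Proof. by move=> f g h; apply: functional_extensionality_dep => i; exact: mulgA. Qed.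

Let mul1 : left_id one mul.
Proof. by move=> f; apply: functional_extensionality_dep => i; exact: mul1g. Qed.

Let mulr1 : right_id one mul.
Proof. by move=> f; apply: functional_extensionality_dep => i; exact: mulg1. Qed.

Let mulV : left_inverse one inv mul.
Proof. by move=> f; apply: functional_extensionality_dep => i; exact: mulVg. Qed.

Let mulrV : right_inverse one inv mul.
Proof. by move=> f; apply: functional_extensionality_dep => i; exact: mulgV. Qed.

HB.instance Definition _ :=
  isGroup.Build (prodg L) mulA mul1 mulr1 mulV mulrV.

End DirectProduct.

(* Main.v *)
Require Import Defs.
From HB Require Import structures.
From mathcomp Require Import all_boot all_order all_algebra.
From mathcomp Require Import all_classical.
From mathcomp Require Import zify ring.

(** If [u] and [v] have the same normal closure, each is a product of conjugates
of the other and of its inverse.  The exponent sum [n] of such a product is in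
general not determined by [u] and [v], but it is in limit groups: in a limit
group, a product of conjugates of [a] and [a^-1] that is trivial has exponent sum
zero unless [a = 1] ([sela_exponent_rigid]).  Together with the Magnus property
this gives more than conjugacy up to a sign: the sign is the exponent sum
([magnus_rigid_cases]).

In a direct product, a product of conjugates projects to every coordinate with
the same exponent sum, so the signs found in the nontrivial limit group
coordinates coincide.  What is left is the coordinate in [C], where, after
replacing [v] by its inverse if necessary, [c] and [d] are products of conjugates
of each other with exponent sum [1].  Pick [x] nontrivial in the limit group [L]
for which [L * C] has the Magnus property.  Conjugating only in [C] shows that
[(x, c)] and [(x, d)] have the same normal closure, hence they are conjugate up to
a sign, and the sign is positive since [x] is not conjugate to its inverse
([conjugate_right_factor]).  If all limit group coordinates are trivial, the
Magnus property of [C] suffices, and [C] inherits it as a retract of [L * C].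
This proves that the first statement implies the second ([magnus_prod]).  For the
converse, the group of integers is a limit group with the Magnus property, and
the product over a single index can be used.

The determinacy of exponent sums passes to limit groups from free groups, since a
relation in [L] holds in the free group under almost all homomorphisms of the
stable sequence.  For a nontrivial element [a] of a free group, a finite piece of
the Magnus expansion provides a unitriangular integer representation [rho] with
[rho a <> 1] ([word_letter_unit_neq1]).  Conjugation does not affect the lowest
nonzero superdiagonal of [rho a - 1], and multiplication of unitriangular matrices
is additive there, so a product of conjugates with exponent sum [n] has [n] times
that superdiagonal ([unitriangular_rigid]). *)

Set Implicit Arguments.
Unset Strict Implicit.
Unset Printing Implicit Defensive.

Local Open Scope group_scope.

(** * Homomorphisms and integer powers *)

Section Morph.
Context {G H : groupType} {f : G -> H} (fM : {morph f : x y / x * y}).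

Lemma morph_one : f 1 = 1.
Proof. by apply: (mulgI (f 1)); rewrite -fM !mulg1. Qed.

Lemma morph_inv x : f x^-1 = (f x)^-1.
Proof. by apply: (mulgI (f x)); rewrite -fM !mulgV morph_one. Qed.

Lemma morph_conj x y : f (x ^ y) = f x ^ f y.
Proof. by rewrite !conjgE !fM morph_inv. Qed.
End Morph.

Section IntPowers.
Variable G : groupType.
Implicit Type x : G.

Definition expgz x (n : int) : G :=
  match n with Posz m => x ^+ m | Negz m => x ^- m.+1 end.

Lemma expgzS x n : expgz x (n + 1)%R = x * expgz x n.
Proof.
case: n => [m|[|m]].
- by rewrite -PoszD addn1 /= expgS.
- by rewrite /= expg1 mulgV.
- rewrite NegzE (_ : (_ + 1)%R = Negz m); last first.
    by rewrite !NegzE -[in LHS]addn1 PoszD GRing.opprD GRing.addrNK.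
  by rewrite /= [in RHS]expgSr invgM mulVKg.
Qed.

Lemma expgzP x n : expgz x (n - 1)%R = x^-1 * expgz x n.
Proof. by rewrite -[n in RHS](GRing.subrK 1%R) expgzS mulKg. Qed.

Lemma expgzD x m n : expgz x (m + n)%R = expgz x m * expgz x n.
Proof.
elim: m => [|m IH|m IH].
- by rewrite GRing.add0r mul1g.
- by rewrite -addn1 PoszD GRing.addrAC !expgzS IH mulgA.
- by rewrite -addn1 PoszD GRing.opprD GRing.addrAC !expgzP IH mulgA.
Qed.

Lemma expgz1 x : expgz x 1 = x. Proof. by []. Qed.
End IntPowers.

Lemma morph_expgz (G H : groupType) (f : G -> H) (fM : {morph f : x y / x * y})
  x n : f (expgz x n) = expgz (f x) n.
Proof.
elim: n => [|n IH|n IH]; first exact: (morph_one fM).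
- by rewrite -addn1 PoszD !expgzS fM IH.
- by rewrite -addn1 PoszD GRing.opprD !expgzP fM IH (morph_inv fM).
Qed.

(** * Products of conjugates and their exponent sums *)

(** The elements of the normal closure of [a] are the products of conjugates of
[a] and [a^-1].  The integer records the exponent sum of such a product; it
depends on the chosen product, and the whole argument turns on when it does
not. *)
Inductive normal_prod {G : groupType} (a : G) : int -> G -> Prop :=
| normal_prod1 : normal_prod a 0%R 1
| normal_prodM n x g :
    normal_prod a n x -> normal_prod a (n + 1)%R (x * a ^ g)
| normal_prodV n x g :
    normal_prod a n x -> normal_prod a (n - 1)%R (x * (a ^ g)^-1).

Section NormalProd.
Variable G : groupType.
Implicit Types (a x y g : G) (m n : int).

Lemma normal_prod_conj a g : normal_prod a 1%R (a ^ g).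
Proof. by have := normal_prodM g (normal_prod1 a); rewrite mul1g. Qed.

Lemma normal_prod_id a : normal_prod a 1%R a.
Proof. by have := normal_prod_conj a 1; rewrite conjg1. Qed.

Lemma normal_prod_mul a m n x y :
  normal_prod a m x -> normal_prod a n y -> normal_prod a (m + n)%R (x * y).
Proof.
move=> ax; elim=> [|k z g _ IH|k z g _ IH]; first by rewrite mulg1 GRing.addr0.
- by rewrite mulgA GRing.addrA; apply: normal_prodM.
- by rewrite mulgA GRing.addrA; apply: normal_prodV.
Qed.

Lemma normal_prod_inv a n x : normal_prod a n x -> normal_prod a (- n)%R x^-1.
Proof.
elim=> [|k z g _ IH|k z g _ IH]; first by rewrite invg1; exact: normal_prod1.
- rewrite invgM GRing.opprD GRing.addrC; apply: normal_prod_mul IH.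
  by have := normal_prodV g (normal_prod1 a); rewrite mul1g.
- rewrite invgM invgK GRing.opprD GRing.opprK GRing.addrC.
  by apply: normal_prod_mul IH; exact: normal_prod_conj.
Qed.

Lemma normal_prodJ a n x h : normal_prod a n x -> normal_prod a n (x ^ h).
Proof.
elim=> [|k z g _ IH|k z g _ IH]; first by rewrite conj1g; exact: normal_prod1.
- by rewrite conjMg -conjgM; apply: normal_prodM.
- by rewrite conjMg conjVg -conjgM; apply: normal_prodV.
Qed.

Lemma normal_prod_baseV a n x : normal_prod a n x -> normal_prod a^-1 (- n)%R x.
Proof.
elim=> [|k z g _ IH|k z g _ IH]; first exact: normal_prod1.
- rewrite GRing.opprD -[a ^ g]invgK -conjVg; exact: normal_prodV.
- rewrite GRing.opprD GRing.opprK -conjVg; exact: normal_prodM.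
Qed.

Lemma normal_prod_base1 n x : normal_prod 1 n x -> x = 1.
Proof.
by elim=> // [k z g _ ->|k z g _ ->]; rewrite conj1g ?invg1 mulg1.
Qed.

Lemma normal_prod_morph (H : groupType) (f : G -> H)
    (fM : {morph f : x y / x * y}) a n x :
  normal_prod a n x -> normal_prod (f a) n (f x).
Proof.
elim=> [|k z g _ IH|k z g _ IH]; first by rewrite (morph_one fM); exact: normal_prod1.
- by rewrite fM (morph_conj fM); apply: normal_prodM.
- by rewrite fM (morph_inv fM) (morph_conj fM); apply: normal_prodV.
Qed.

(** The conjugators of a product can be lifted one by one, so a relation in a
quotient group comes from an identity with the same exponent sum upstairs. *)
Lemma normal_prod_lift (H : groupType) (p : H -> G)
    (pM : {morph p : x y / x * y}) (p_surj : forall y, exists h : H, p h = y) b n y :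
  normal_prod (p b) n y -> exists2 h : H, p h = y & normal_prod b n h.
Proof.
elim=> [|k z g _ [x <- bx]|k z g _ [x <- bx]].
- by exists 1; [exact: morph_one|exact: normal_prod1].
- have [h <-] := p_surj g; exists (x * b ^ h); last exact: normal_prodM.
  by rewrite pM (morph_conj pM).
- have [h <-] := p_surj g; exists (x * (b ^ h)^-1); last exact: normal_prodV.
  by rewrite pM (morph_inv pM) (morph_conj pM).
Qed.

Lemma normal_closureP a x : normal_closure a x <-> exists n, normal_prod a n x.
Proof.
split; last first.
  case=> n ax B [[[B1 BF] BJ] /(_ a erefl) Ba].
  have BV y : B y -> B y^-1 by move=> By; rewrite -div1g; apply: BF.
  have BM y z : B y -> B z -> B (y * z).
    by move=> By Bz; rewrite -[z]invgK; apply/BF/BV.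
  elim: ax => // [k z g _ Bz|k z g _ Bz]; first exact/BM/BJ.
  exact/BM/BV/BJ.
apply: (_ : normal_closure a `<=` [set x | exists n, normal_prod a n x])%classic.
apply: smallest_sub; last by move=> _ ->; exists 1%R; exact: normal_prod_id.
split; last by move=> y g [n ay]; exists n; exact: normal_prodJ.
split; first by exists 0%R; exact: normal_prod1.
move=> y z [m ay] [n az]; exists (m - n)%R.
exact/normal_prod_mul/normal_prod_inv.
Qed.

Lemma eq_normal_closureP a b : normal_closure a = normal_closure b <->
  (exists n, normal_prod a n b) /\ (exists n, normal_prod b n a).
Proof.
split=> [ab|[/normal_closureP ab /normal_closureP ba]].
- by rewrite -!normal_closureP ab -{2}ab; split;
    apply/normal_closureP; exists 1%R; exact: normal_prod_id.
- apply/seteqP; split=> x xin B NB; apply: xin; split; try exact: NB.1;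
    move=> _ ->; [exact: ba|exact: ab].
Qed.
End NormalProd.

(** * Groups in which exponent sums are determined *)

(** Equivalently, [a ^+ n] lies in the commutator subgroup of the normal closure
of [a] with [G] only when [n = 0] or [a = 1].  Torsion-freeness alone does not
give this: in the Klein bottle group, where [t] inverts [a] by conjugation, the
product [a * a ^ t] is trivial although its exponent sum is [2]. *)
Definition exponent_rigid (G : groupType) : Prop :=
  forall (a : G) n, normal_prod a n 1 -> a <> 1 -> n = 0%R.

Lemma exponent_unique (G : groupType) : exponent_rigid G ->
  forall (a b : G) m n,
    a <> 1 -> normal_prod a m b -> normal_prod a n b -> m = n.
Proof.
move=> rG a b m n a1 am an; apply/eqP; rewrite -GRing.subr_eq0; apply/eqP.
apply: (rG a) => //; rewrite -(mulgV b).
exact/normal_prod_mul/normal_prod_inv.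
Qed.

Lemma conjugate_sym (G : groupType) (a b : G) : conjugate a b -> conjugate b a.
Proof. by case=> g ->; exists g^-1; rewrite conjgK. Qed.

Lemma normal_prod_conjugate (G : groupType) (a b : G) :
  conjugate a b -> normal_prod a 1%R b.
Proof. by move=> /conjugate_sym[g ->]; exact: normal_prod_conj. Qed.

Lemma normal_prod_conjugateV (G : groupType) (a b : G) :
  conjugate a b^-1 -> normal_prod a (- 1)%R b.
Proof.
by move=> /normal_prod_conjugate/normal_prod_inv; rewrite invgK.
Qed.

(** The sign in the Magnus property is not a choice: when [a] and [b] have the
same normal closure, it is the exponent sum of any product of conjugates of [a]
equal to [b], and rigidity makes all these sums agree. *)
Lemma magnus_rigid_cases (G : groupType) : exponent_rigid G -> magnus_property G ->
  forall (a b : G) m n, a <> 1 -> normal_prod a m b -> normal_prod b n a ->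
  (m = 1%R /\ n = 1%R /\ conjugate a b) \/
  (m = (- 1)%R /\ n = (- 1)%R /\ conjugate a b^-1).
Proof.
move=> rG mG a b m n a1 ab ba.
have b1 : b <> 1 by move=> b1; apply: a1; move: ba; rewrite b1 => /normal_prod_base1.
have /mG[cab|cab] : normal_closure a = normal_closure b.
  by apply/eq_normal_closureP; split; [exists m|exists n].
- left; split; last split=> //.
    exact: exponent_unique ab (normal_prod_conjugate cab).
  exact: exponent_unique ba (normal_prod_conjugate (conjugate_sym cab)).
- right; split; last split=> //.
    exact: exponent_unique ab (normal_prod_conjugateV cab).
  apply: exponent_unique ba _ => //; apply: normal_prod_conjugateV.
  by case: cab => g ->; exists g^-1; rewrite -conjVg invgK conjgK.
Qed.

(** Homomorphisms preserve equality of normal closures and conjugacy, so the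
property of the big group can be pulled back along the section and the answer
pushed down by the retraction. *)
Lemma magnus_retract (G H : groupType) (f : H -> G) (r : G -> H)
    (fM : {morph f : x y / x * y}) (rM : {morph r : x y / x * y}) :
  cancel f r -> magnus_property G -> magnus_property H.
Proof.
move=> fK mG u v /eq_normal_closureP[[m uv] [n vu]].
have /mG[[g]|[g]] : normal_closure (f u) = normal_closure (f v).
  by apply/eq_normal_closureP; split; [exists m|exists n]; exact: normal_prod_morph.
- by move=> /(congr1 r); rewrite (morph_conj rM) !fK; left; exists (r g).
- move=> /(congr1 r); rewrite (morph_conj rM) (morph_inv rM) !fK; right.
  by exists (r g).
Qed.

(** Conjugators with trivial first coordinate leave [x] alone, so the first
coordinate only sees the exponent sum. *)
Lemma normal_prod_pair (L C : groupType) (x : L) (c d : C) n :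
  normal_prod c n d -> normal_prod ((x, c) : (L * C)%type) n (expgz x n, d).
Proof.
have pairJ g : ((x, c) : (L * C)%type) ^ (1, g) = (x, c ^ g).
  by congr (_, _); exact: conjg1.
elim=> [|k z g _ IH|k z g _ IH]; first exact: normal_prod1.
- have := normal_prodM (1, g) IH; rewrite pairJ expgzD expgz1.
  exact.
- have := normal_prodV (1, g) IH; rewrite pairJ expgzD.
  exact.
Qed.

Lemma magnus_right_factor (L C : groupType) :
  magnus_property (L * C)%type -> magnus_property C.
Proof.
apply: (@magnus_retract (L * C)%type C (fun c => (1, c)) snd) => //.
by move=> c d; congr (_, _); rewrite /= mulg1.
Qed.

(** This is where the hypothesis on [L * C] enters: nothing makes exponent sums
in [C] rigid, so a nontrivial element [x] of [L] is attached to keep track of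
them.  The elements [(x, c)] and [(x, d)] have the same normal closure because
both exponent sums are [1].  If [(x, c)] were conjugate to the inverse of
[(x, d)], then [x] would be conjugate to its inverse, and [x] would be a product
of conjugates of [x] with exponent sum [-1] as well as [1]. *)
Lemma conjugate_right_factor (L C : groupType) (x : L) :
  exponent_rigid L -> x <> 1 -> magnus_property (L * C)%type ->
  forall c d : C, normal_prod c 1%R d -> normal_prod d 1%R c -> conjugate c d.
Proof.
move=> rL x1 mLC c d cd dc.
have /mLC[] : normal_closure ((x, c) : (L * C)%type) = normal_closure ((x, d) : (L * C)%type).
  by apply/eq_normal_closureP; split; exists 1%R; exact: (normal_prod_pair x).
- by case=> g /(congr1 snd) /= ->; exists g.2.
- case=> g /(congr1 fst) xV; exfalso.
  have /normal_prod_conjugateV xx : conjugate x x^-1 by exists g.1.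
  by have := exponent_unique rL x1 (normal_prod_id x) xx.
Qed.

Lemma conjugate_prod (I : Type) (L : I -> groupType) (C : groupType)
    (u v : (prodg L * C)%type) :
  (forall i, conjugate (u.1 i) (v.1 i)) -> conjugate u.2 v.2 -> conjugate u v.
Proof.
move=> uv1 [g2 uv2]; exists ((fun i => sval (cid (uv1 i))), g2).
case: u v uv1 uv2 => [f c] [f' c'] /= uv1 ->; congr (_, _).
by apply: functional_extensionality_dep => i; rewrite {1}(svalP (cid (uv1 i))).
Qed.

(** A product of conjugates in the direct product projects to every coordinate
with one and the same exponent sum.  In each nontrivial rigid coordinate this sum
is the sign with which the coordinates of [u] and [v] are conjugate, so one sign
serves all coordinates, and it is also the exponent sum in [C]. *)
Lemma magnus_prod (I : Type) (L : I -> groupType) (L0 C : groupType) :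
  exponent_rigid L0 -> (exists x : L0, x <> 1) -> magnus_property (L0 * C)%type ->
  (forall i, exponent_rigid (L i) /\ magnus_property (L i)) ->
  magnus_property (prodg L * C)%type.
Proof.
move=> r0 [x x1] m0 rmL u v /eq_normal_closureP[[m uv] [n vu]].
have coord w w' k i : @normal_prod (prodg L * C)%type w k w' ->
    normal_prod (w.1 i) k (w'.1 i).
  by apply: (@normal_prod_morph _ _ (fun w : (prodg L * C)%type => w.1 i)).
have right w w' k : @normal_prod (prodg L * C)%type w k w' ->
    normal_prod w.2 k w'.2.
  by apply: (@normal_prod_morph _ _ (fun w : (prodg L * C)%type => w.2)).
have triv i : u.1 i = 1 -> v.1 i = 1.
  by move=> u1; move: (coord _ _ _ i uv); rewrite u1 => /normal_prod_base1.
have trivV i : u.1 i = 1 -> (v^-1).1 i = 1.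
  by move=> /triv v1; rewrite -[LHS]/((v.1 i)^-1) v1 invg1.
(* One nontrivial coordinate is enough to force both exponent sums to be equal
   to the same sign. *)
have [[i ui1]|u1] := pselect (exists i, u.1 i <> 1).
  have [rLi mLi] := rmL i.
  case: (magnus_rigid_cases rLi mLi ui1 (coord _ _ _ i uv) (coord _ _ _ i vu)).
  - move=> [m1 [n1 _]]; subst m n; left; apply: conjugate_prod.
    + move=> j; have [uj1|uj1] := pselect (u.1 j = 1).
        by exists 1; rewrite uj1 triv // conj1g.
      have [rLj mLj] := rmL j.
      by case: (magnus_rigid_cases rLj mLj uj1 (coord _ _ _ j uv) (coord _ _ _ j vu))
        => [[_ []]|[]].
    + by apply: conjugate_right_factor m0 _ _ _ _; eauto.
  - move=> [m1 [n1 _]]; subst m n; right; apply: conjugate_prod.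
    + move=> j; have [uj1|uj1] := pselect (u.1 j = 1).
        by exists 1; rewrite uj1 trivV // conj1g.
      have [rLj mLj] := rmL j.
      by case: (magnus_rigid_cases rLj mLj uj1 (coord _ _ _ j uv) (coord _ _ _ j vu))
        => [[]|[_ []]].
    + apply: (conjugate_right_factor r0 x1 m0).
        exact: normal_prod_inv (right _ _ _ uv).
      exact: normal_prod_baseV (right _ _ _ vu).
(* With all coordinates trivial no sign is imposed, and [C] alone decides. *)
have {}u1 i : u.1 i = 1 by apply: contrapT => ?; apply: u1; exists i.
have /(magnus_right_factor m0)[c|c] : normal_closure u.2 = normal_closure v.2.
  by apply/eq_normal_closureP; split; [exists m|exists n]; exact: right.
- by left; apply: conjugate_prod => // i; exists 1; rewrite u1 triv // conj1g.
- by right; apply: conjugate_prod => // i; exists 1; rewrite u1 trivV // conj1g.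
Qed.

(** * Generation of free groups *)

Section SubgroupType.
Variables (G : groupType) (S : set G).

(** The closure proof is an argument of the type so that the group structure can
be inferred from the type alone. *)
Definition subgroup_type of is_subgroup S : Type := {x : G | x \in S}.

Hypothesis subS : is_subgroup S.

HB.instance Definition _ := SubChoice.on (subgroup_type subS).

Let closedS : group_closed [pred x : G | x \in S].
Proof.
split; first exact/mem_set/subS.1.
by move=> x y /set_mem Sx /set_mem Sy; apply/mem_set/subS.2.
Qed.

HB.instance Definition _ :=
  SubChoice_isSubGroup.Build G _ (subgroup_type subS) closedS.
End SubgroupType.

(** The universal property gives a homomorphism from [F] to the subgroup [S] that
fixes the basis.  Followed by the inclusion it is the identity, by uniqueness,
so every element lies in [S]. *)
Lemma free_basis_generates (X : Type) (F : groupType) (e : X -> F) (S : set F) :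
  free_basis e -> is_subgroup S -> (forall i, S (e i)) -> forall g, S g.
Proof.
move=> freeF subS Se g.
have [phi [phie _]] := freeF (subgroup_type subS) (fun i => Sub (e i) (mem_set (Se i))).
have [id' [_ uniq]] := freeF F e.
have vphi : (val \o phi : {multiplicative F -> F}) =1 id'.
  by apply: uniq => i /=; rewrite phie SubK.
have idid : (idfun : {multiplicative F -> F}) =1 id' by apply: uniq.
rewrite (_ : g = val (phi g)); first exact: set_mem (valP (phi g)).
by rewrite -[LHS]/(idfun g) idid -vphi.
Qed.

(** * The group of units of a ring *)

Section UnitGroup.
Variable R : unitRingType.

Definition unit_group : Type := {x : R | x \is a GRing.unit}.
HB.instance Definition _ := SubChoice.on unit_group.

Implicit Types x y : unit_group.
Open Scope ring_scope.
Let one : unit_group := Sub 1 (GRing.unitr1 R).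
Let mul_proof x y : val x * val y \is a GRing.unit.
Proof. by rewrite GRing.unitrMl ?(valP x) ?(valP y). Qed.
Let mul x y : unit_group := Sub (val x * val y) (mul_proof x y).
Let inv_proof x : (val x)^-1 \is a GRing.unit.
Proof. by rewrite GRing.unitrV (valP x). Qed.
Let inv x : unit_group := Sub (val x)^-1 (inv_proof x).

Let mulA : associative mul.
Proof. by move=> x y z; apply: val_inj; rewrite /= GRing.mulrA. Qed.
Let mul1 : left_id one mul.
Proof. by move=> x; apply: val_inj; rewrite /= GRing.mul1r. Qed.
Let mulr1 : right_id one mul.
Proof. by move=> x; apply: val_inj; rewrite /= GRing.mulr1. Qed.
Let mulV : left_inverse one inv mul.
Proof. by move=> x; apply: val_inj; rewrite /= GRing.mulVr ?(valP x). Qed.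
Let mulrV : right_inverse one inv mul.
Proof. by move=> x; apply: val_inj; rewrite /= GRing.mulrV ?(valP x). Qed.

HB.instance Definition _ := isGroup.Build unit_group mulA mul1 mulr1 mulV mulrV.

Lemma val_unit1 : val (1%g : unit_group) = 1. Proof. by []. Qed.
Lemma val_unitM x y : val (x * y)%g = val x * val y. Proof. by []. Qed.
End UnitGroup.

Import GRing.Theory.
Local Open Scope classical_set_scope.
Local Open Scope ring_scope.

(** * Unitriangular integer representations *)

Lemma mulmxzE m n (A : 'M[int]_(m, n)) k i j : (A *~ k) i j = A i j *~ k.
Proof.
by case: k => p; rewrite ?NegzE ?mulrNz -?pmulrn ?[in LHS]mxE mulmxnE.
Qed.

Section Upper.
Variable n : nat.
Implicit Types A B : 'M[int]_n.+1.

(** The matrices supported on the [d]-th superdiagonal and above.  They form the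
filtration by which [rho g - 1] is measured, as the degree does for the Magnus
expansion in noncommuting power series. *)
Definition upper d A : Prop :=
  forall i j : 'I_n.+1, (j < i + d)%N -> A i j = 0.

Lemma upperD d A B : upper d A -> upper d B -> upper d (A + B).
Proof. by move=> uA uB i j ij; rewrite mxE uA // uB // addr0. Qed.

Lemma upperN d A : upper d A -> upper d (- A).
Proof. by move=> uA i j ij; rewrite mxE uA // oppr0. Qed.

Lemma upperB d A B : upper d A -> upper d B -> upper d (A - B).
Proof. by move=> uA uB; exact/upperD/upperN. Qed.

Lemma upper1 : upper 0 1.
Proof.
by move=> i j; rewrite addn0 mxE -val_eqE /= => /ltn_eqF; rewrite eq_sym => ->.
Qed.

Lemma upper_unipotent A : upper 1 (A - 1) -> upper 0 A.
Proof.
move=> uA; rewrite -(subrK 1 A); apply: upperD upper1.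
by move=> i j ij; apply: uA; rewrite addn0 in ij; rewrite addn1 ltnS ltnW.
Qed.

Lemma upperM d d' A B : upper d A -> upper d' B -> upper (d + d') (A * B).
Proof.
move=> uA uB i j ij; rewrite mxE big1 // => k _.
have [ki|ik] := ltnP k (i + d); first by rewrite uA // mul0r.
by rewrite (uB k) ?mulr0 //; lia.
Qed.

Lemma upper_weaken d d' A : (d' <= d)%N -> upper d A -> upper d' A.
Proof. by move=> dd uA i j ij; apply: uA; lia. Qed.

Lemma upper_depth A : A <> 0 -> upper 1 A ->
  exists d, [/\ (0 < d)%N, upper d A & ~ upper d.+1 A].
Proof.
move=> A0 uA.
have exd : exists d, ~~ `[< upper d A >].
  exists n.+1; apply/asboolPn => uA'; apply: A0; apply/matrixP => i j.
  by rewrite mxE uA' //; have := ltn_ord j; lia.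
case: (ex_minnP exd) => d /asboolPn nud mind.
case: d nud mind => [|[|d]] nud mind; [|by []|].
  by case: nud; exact: upper_weaken uA.
exists d.+1; split=> //; apply: contrapT => nud'.
by have := mind d.+1; rewrite ltnn => H; move/asboolPn: nud' => /H.
Qed.
End Upper.

Section UnitriangularRep.
Variables (G : groupType) (n : nat) (rho : G -> 'M[int]_n.+1).
Hypothesis rho1 : rho 1%g = 1.
Hypothesis rhoM : forall x y, rho (x * y)%g = rho x * rho y.
Hypothesis rhoU : forall g, upper 1 (rho g - 1).

(** Conjugation changes [rho a] by a unit multiple of the commutator of
[rho a - 1] and [rho g - 1], which lies one superdiagonal higher. *)
Lemma unipotent_conj d a g : upper d (rho a - 1) ->
  upper d.+1 (rho (a ^ g)%g - rho a).
Proof.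
move=> ua.
have -> : rho (a ^ g)%g - rho a =
    rho g^-1%g * ((rho a - 1) * (rho g - 1) - (rho g - 1) * (rho a - 1)).
  have -> : (rho a - 1) * (rho g - 1) - (rho g - 1) * (rho a - 1)
            = rho a * rho g - rho g * rho a.
    rewrite !mulrBl !mulrBr !mul1r !mulr1.
    by apply/matrixP => i j; rewrite !mxE; ring.
  by rewrite mulrBr -!rhoM mulKg conjgE.
rewrite -[d.+1]add0n; apply: upperM (upper_unipotent (rhoU _)) _.
by apply: upperB; [rewrite -addn1|rewrite -add1n]; apply: upperM.
Qed.

(** Modulo the next superdiagonal, conjugates of [a] all have the same image and
products [(1 + M) * (1 + N)] become [1 + (M + N)]; hence the lowest part of
[rho a - 1] gets multiplied by the exponent sum. *)
Lemma normal_prod_unipotent d a k x : (0 < d)%N -> upper d (rho a - 1) ->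
  normal_prod a k x -> upper d.+1 (rho x - 1 - (rho a - 1) *~ k).
Proof.
move=> d0 ua.
(* The claim for [y * a ^ g] and the claim for [y] differ by an error in the
   next superdiagonal.  Read from [y * a ^ g] to [y], this also treats inverse conjugates. *)
have step y g m : upper d.+1 (rho (y * a ^ g)%g - 1 - (rho a - 1) *~ (m + 1)
                               - (rho y - 1 - (rho a - 1) *~ m)).
  have -> : rho (y * a ^ g)%g - 1 - (rho a - 1) *~ (m + 1)
              - (rho y - 1 - (rho a - 1) *~ m)
            = (rho y - 1) * (rho a - 1) + rho y * (rho (a ^ g)%g - rho a).
    rewrite rhoM mulrzDr mulr1z !mulrBl !mulrBr !mul1r !mulr1.
    by apply/matrixP => i j; rewrite !mxE; ring.
  apply: upperD; first by rewrite -add1n; apply: upperM.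
  by rewrite -[d.+1]add0n; apply: upperM (upper_unipotent (rhoU _)) (unipotent_conj _ ua).
elim=> [|m y g _ IH|m y g _ IH].
- by rewrite rho1 subrr mulr0z subr0 => i j _; rewrite mxE.
- by rewrite -[X in upper _ X](subrK (rho y - 1 - (rho a - 1) *~ m)); exact: upperD.
- have := step (y * (a ^ g)^-1)%g g (m - 1); rewrite mulgVK subrK => st.
  by have := upperB IH st; rewrite opprB addrC subrK.
Qed.

(** At the lowest superdiagonal where [rho a - 1] does not vanish, a relation with
exponent sum [k] says that [k] times a nonzero integer is zero. *)
Lemma unitriangular_rigid a k : normal_prod a k 1%g -> rho a <> 1 -> k = 0.
Proof.
move=> ak a1.
have [|d [d0 ud nud]] := upper_depth _ (rhoU a).
  by move/eqP; rewrite subr_eq0 => /eqP.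
have := normal_prod_unipotent d0 ud ak; rewrite rho1 subrr sub0r => ukN.
apply: contrapT => k0; apply: nud => i j ij.
have := ukN i j ij.
by rewrite mxE mulmxzE => /eqP; rewrite oppr_eq0 mulrz_eq0 => /orP[/eqP //|/eqP].
Qed.
End UnitriangularRep.

(** * Reduced words *)

Section Words.
Variables (X : eqType) (G : groupType) (e : X -> G).
Implicit Type s : seq (X * int).

Definition word s : G := (\prod_(p <- s) expgz (e p.1) p.2)%g.

(** Letters carry nonzero integer exponents instead of signs: adjacent letters of a
reduced word are then distinct, which is what makes the matrices below square to
zero. *)
Definition reduced s : bool :=
  sorted (fun p q => p.1 != q.1) s && all (fun p => p.2 != 0) s.

Lemma word_cons p s : word (p :: s) = (expgz (e p.1) p.2 * word s)%g.
Proof. by rewrite /word big_cons. Qed.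

Lemma word_cat s t : word (s ++ t) = (word s * word t)%g.
Proof. by rewrite /word big_cat. Qed.

Lemma word1 x : word [:: (x, 1)] = e x.
Proof. by rewrite /word big_seq1. Qed.

Lemma word_inv s : exists t, word t = (word s)^-1%g.
Proof.
elim: s => [|[x m] s [t wt]]; first by exists [::]; rewrite /word big_nil invg1.
exists (t ++ [:: (x, - m)]).
rewrite word_cat wt word_cons invgM /word big_seq1 /=; congr (_ * _)%g.
by apply: (mulgI (expgz (e x) m)); rewrite -expgzD subrr mulgV.
Qed.

Lemma word_reduced s : exists2 t, reduced t & word t = word s.
Proof.
elim: s => [|[x m] s [t rt wt]]; first by exists [::].
rewrite word_cons -{}wt /=.
have [->|m0] := eqVneq m 0; first by exists t; rewrite ?mul1g.
case: t rt => [|[y k] t] /=.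
  by exists [:: (x, m)]; rewrite ?word_cons // /reduced /= m0.
rewrite /reduced /= => /and3P[pt k0 at_].
have [xy|xy] := eqVneq x y; last first.
  exists [:: (x, m), (y, k) & t]; last by rewrite !word_cons.
  by rewrite /reduced /= xy pt m0 k0.
subst y; rewrite word_cons mulgA -expgzD /=.
have [mk|mk] := eqVneq (m + k) 0.
  by exists t; rewrite ?mk ?mul1g // at_ (path_sorted pt).
exists ((x, m + k) :: t); last by rewrite word_cons.
by rewrite /= mk at_ !andbT; case: (t) pt.
Qed.

Lemma is_subgroup_words : is_subgroup [set g | exists s, word s = g]%classic.
Proof.
split; first by exists [::]; rewrite /word big_nil.
by move=> _ _ [s <-] [t <-]; have [t' wt] := word_inv t;
  exists (s ++ t'); rewrite word_cat wt.
Qed.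
End Words.

(** * Magnus matrices of a reduced word *)

Section MagnusMatrices.
Variables (X : eqType) (x0 : X) (s : seq (X * int)).
Hypothesis reds : reduced s.
Let r := size s.
Let letter (a : nat) : X := (nth (x0, 0) s a).1.

(** The entries on the first superdiagonal spell the word [s], and [letter_mx x]
marks the positions of the letter [x].  Sending [x] to [1 + letter_mx x] is the
Magnus expansion cut down to the monomials that occur as contiguous factors of
[s]. *)
Definition letter_mx x : 'M[int]_r.+1 :=
  \matrix_(a, b) ((b == a.+1 :> nat) && (letter a == x))%:R.

(** A nonzero entry of the square would be an occurrence of [x] at two consecutive
positions of [s]. *)
Lemma letter_mx_sqr0 x : letter_mx x * letter_mx x = 0.
Proof.
apply/matrixP => a c; rewrite !mxE big1 // => b _; rewrite !mxE.
have [/andP[/eqP ba /eqP xa]|_] := boolP (_ && _); last by rewrite mul0r.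
have [/andP[/eqP cb /eqP xb]|_] := boolP (_ && _); last by rewrite mulr0.
have ltar : (a.+1 < size s)%N by have := ltn_ord c; rewrite cb ba ltnS.
have /andP[/sortedP-/(_ (x0, 0))/(_ a ltar)] := reds.
by rewrite -ba -/(letter a) -/(letter b) xa xb eqxx.
Qed.

Lemma letter_mx_upper x : upper 1 (letter_mx x).
Proof. by move=> a b ab; rewrite mxE; case: eqP => // ba; move: ab; rewrite ba addn1 ltnn. Qed.

Lemma letter_mx_unit x : 1 + letter_mx x \is a GRing.unit.
Proof.
apply/unitrP; exists (1 - letter_mx x); have sq := letter_mx_sqr0 x.
by rewrite !(mulrDl, mulrDr, mulNr, mulrN, mul1r, mulr1) sq !(addr0, oppr0); split;
  rewrite ?addrNK ?addrK //.
Qed.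

Definition letter_unit x : unit_group 'M[int]_r.+1 :=
  Sub (1 + letter_mx x) (letter_mx_unit x).

(** Since [letter_mx x] squares to zero, the binomial expansion of the power stops
after its linear term. *)
Lemma val_letter_unitX x m :
  val (expgz (letter_unit x) m) = 1 + letter_mx x *~ m.
Proof.
have sq := letter_mx_sqr0 x.
have valV : val ((letter_unit x)^-1)%g = 1 - letter_mx x.
  apply: (mulrI (letter_mx_unit x));
  rewrite -[LHS]/(val (letter_unit x * (letter_unit x)^-1)%g) mulgV val_unit1.
  by rewrite !(mulrDl, mulrDr, mulNr, mulrN, mul1r, mulr1) sq !(addr0, oppr0) subrK.
elim: m => [|m IH|m IH]; first by rewrite mulr0z addr0.
- have -> : m.+1%:Z = m%:Z + 1 by rewrite intS addrC.
  rewrite expgzS val_unitM IH mulrzDr mulr1z /=.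
  rewrite !(mulrDl, mulrDr, mulNr, mulrN, mul1r, mulr1) mulrzAr sq mul0rz addr0.
  by rewrite -addrA; congr (1 + _); rewrite addrC.
- have -> : - m.+1%:Z = - m%:Z - 1 by rewrite intS opprD addrC.
  rewrite expgzP val_unitM valV IH mulrzDr /=.
  rewrite !(mulrDl, mulrDr, mulNr, mulrN, mul1r, mulr1) mulrzAr sq mul0rz.
  by rewrite oppr0 addr0 mulrN1z addrA addrAC.
Qed.

(** Each further letter of the word moves the end of the first row by one
position and multiplies it by the exponent of that letter, so the entry in
column [t] is the product of the first [t] exponents. *)
Lemma word_letter_unit_row t : (t <= r)%N ->
  forall j : 'I_r.+1, let P := val (word letter_unit (take t s)) in
  ((t < j)%N -> P ord0 j = 0) /\ (t = j :> nat -> P ord0 j != 0).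
Proof.
elim: t => [_ j|t IH tr j]; rewrite /=.
  rewrite take0 /word big_nil mxE -val_eqE /=.
  by split=> [|<-] //; case: (j : nat).
have lets : word letter_unit (take t.+1 s) =
    (word letter_unit (take t s) * expgz (letter_unit (letter t)) (nth (x0, 0%R) s t).2)%g.
  by rewrite (take_nth (x0, 0)) // -cats1 word_cat [in X in (_ * X)%g]/word big_seq1.
have nz : (nth (x0, 0) s t).2 != 0.
  by have /andP[_ /allP] := reds; apply; exact: mem_nth.
rewrite lets val_unitM val_letter_unitX.
set P := val _ in IH *; set m := (nth _ _ _).2 in nz *.
have IHP := IH (ltnW tr).
have entry : (t < j)%N -> (P * (1 + letter_mx (letter t) *~ m)) ord0 j
    = (P * letter_mx (letter t)) ord0 j * m.
  move=> tj; rewrite mulrDr mulr1 mxE (IHP j).1 // add0r mulrzAr mulmxzE.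
  by rewrite -mulrzr intz.
have tail : (t < j)%N -> exists i : 'I_r.+1, j = i.+1 :> nat /\
    (P * letter_mx (letter t)) ord0 j = P ord0 i * (letter i == letter t)%:R.
  case: j {entry} => [[//|j] ltj] tj.
  have ltj' : (j < r.+1)%N by exact: ltnW.
  exists (Ordinal ltj'); split => //.
  rewrite mxE (bigD1 (Ordinal ltj')) //= big1 ?addr0 => [|i ij].
    by rewrite mxE /= eqxx.
  rewrite mxE /=; case: eqP => [[ji]|_]; last by rewrite mulr0.
  by case/eqP: ij; apply: val_inj.
split=> [tj|tj].
  have tj' : (t < j)%N by exact: ltnW.
  have [i [ji Pi]] := tail tj'.
  by rewrite entry // Pi (IHP i).1 ?mul0r //; move: tj; rewrite ji.
have tj' : (t < j)%N by rewrite -tj.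
have [i [ji Pi]] := tail tj'.
have ti : t = i by apply: succn_inj; rewrite tj.
by rewrite entry // Pi mulf_neq0 // mulf_neq0 ?(IHP i).2 // -ti eqxx.
Qed.

Lemma word_letter_unit_neq1 : s != [::] -> val (word letter_unit s) <> 1.
Proof.
move=> s0 w1; have := (word_letter_unit_row (leqnn r) ord_max).2 erefl.
rewrite take_size w1 mxE -val_eqE /=.
by rewrite /r; case: (s) s0.
Qed.
End MagnusMatrices.

(** A nontrivial element is a nonempty reduced word, and the Magnus matrices of
that very word give a unitriangular representation that detects it. *)
Lemma free_exponent_rigid (X : eqType) (F : groupType) (e : X -> F) :
  free_basis e -> exponent_rigid F.
Proof.
move=> freeF a k ak a1.
have [s' ws'] := free_basis_generates freeF (is_subgroup_words e)
  (fun i => ex_intro _ _ (word1 e i)) a.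
have [s reds ws] := word_reduced e s'.
have {s' ws' ws} aws : a = word e s by rewrite ws.
case: s => [|[x0 k0] s0] in reds aws *.
  by case: a1; rewrite aws /word big_nil.
set s := _ :: _ in reds aws.
have [phi [phie _]] := freeF _ (letter_unit x0 reds).
have phiM : {morph phi : x y / (x * y)%g} by exact: gmulfM.
pose rho g := val (phi g).
have rho1 : rho 1%g = 1 by rewrite /rho (morph_one phiM).
have rhoM x y : rho (x * y)%g = rho x * rho y by rewrite /rho phiM.
(* Unitriangularity holds for the generators and passes to products.  The
   inverse is included in [S] so that [S] is visibly a subgroup. *)
have rhoU g : upper 1 (rho g - 1).
  pose S := [set g : F | upper 1 (rho g - 1) /\ upper 1 (rho g^-1%g - 1)]%classic.
  suff : S g by case.
  have SM x y : upper 1 (rho x - 1) -> upper 1 (rho y - 1) ->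
      upper 1 (rho (x * y)%g - 1).
    move=> ux uy; rewrite rhoM.
    have -> : rho x * rho y - 1 = rho x * (rho y - 1) + (rho x - 1).
      by rewrite mulrBr mulr1 addrA subrK.
    by apply: upperD => //; rewrite -[1%N]add0n; apply: upperM => //; exact: upper_unipotent.
  apply: (free_basis_generates freeF).
    split; first by rewrite /S /= invg1 rho1 subrr; split=> i j _; rewrite mxE.
    by move=> x y [ux uxV] [uy uyV]; split; rewrite ?invgF; exact: SM.
  move=> x; have := val_letter_unitX x0 reds x.
  rewrite -phie => val_x; split.
    by rewrite /rho -[phi _]/(expgz (phi (e x)) 1) val_x mulr1z addrAC subrr add0r;
      exact: letter_mx_upper.
  rewrite /rho (morph_inv phiM) -[(phi _)^-1%g]/(expgz (phi (e x)) (-1)) val_x.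
  by rewrite mulrN1z addrAC subrr add0r; apply/upperN/letter_mx_upper.
apply: (unitriangular_rigid rho1 rhoM rhoU ak).
rewrite /rho aws /word.
have -> : phi (\prod_(p <- s) expgz (e p.1) p.2)%g = word (letter_unit x0 reds) s.
  rewrite /word (big_morph phi phiM (morph_one phiM)); apply: eq_bigr => p _.
  by rewrite (morph_expgz phiM) phie.
exact: word_letter_unit_neq1.
Qed.

(** * Limit groups and the group of integers *)

(** A product of conjugates of [a] that is trivial in [L] lifts to an element of
the stable kernel, while a lift of [a] stays outside of it.  For large [n] the
homomorphism [h n] therefore carries the relation into the free group and keeps
the image of [a] nontrivial. *)
Lemma sela_exponent_rigid (L : groupType) : sela_limit_group L -> exponent_rigid L.
Proof.
move=> [k [F [G [e [h [p [freeF _ stab p_surj ker_p]]]]]]] a m.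
have pM : {morph p : x y / (x * y)%g} by exact: gmulfM.
have p_onto y : exists g, p g = y by have [g _ <-] := p_surj y I; exists g.
have [g <- {a}] := p_onto a.
move=> /(normal_prod_lift pM p_onto)[x px1 gx] pg1.
have kx : stable_kernel h x by rewrite -ker_p.
have hg : \forall n \near \oo, h n g <> 1%g.
  have [kg|//] := stab g; case: pg1.
  by have : stable_kernel h g := kg; rewrite -ker_p.
near \oo => n.
have hM : {morph h n : x y / (x * y)%g} by exact: gmulfM.
apply: (free_exponent_rigid freeF (a := h n g)); last by near: n.
have <- : h n x = 1%g by near: n.
exact: normal_prod_morph.
Unshelve. all: by end_near.
Qed.

Lemma indicable_neq1 (G : groupType) : indicable G -> exists x : G, x <> 1%g.
Proof.
move=> [f [fM f_surj]]; have [x _ fx] := f_surj 1 I.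
exists x => x1; have := fM x 1%g I I; rewrite mulg1 fx.
by rewrite -[in X in _ + X]x1 fx.
Qed.

Definition int_group : groupType := Algebra.to_multiplicative int.

Lemma int_group_mulC (x y : int_group) : (x * y = y * x)%g.
Proof. exact: addrC. Qed.

Lemma expgz_Z (m n : int) : @expgz int_group m n = m * n.
Proof.
elim: n => [|n IH|n IH]; first by rewrite mulr0.
- have -> : n.+1%:Z = n%:Z + 1 by rewrite intS addrC.
  by rewrite expgzS IH mulrDr mulr1 addrC.
- have -> : - n.+1%:Z = - n%:Z - 1 by rewrite intS opprD addrC.
  by rewrite expgzP IH mulrDr mulrN1 addrC.
Qed.

Lemma Z_free : @free_basis 'I_1 int_group (fun=> 1).
Proof.
move=> H f; pose phi (n : int_group) : H := expgz (f ord0) n.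
have phiM : {morph phi : x y / (x * y)%g} by move=> x y; exact: expgzD.
pose phiH := isMultiplicative.Build int_group H phi phiM.
pose Phi : {multiplicative int_group -> H} := HB.pack phi phiH.
exists Phi; split=> [i|psi psi1 n]; first by rewrite (ord1 i).
have psiM : {morph psi : x y / (x * y)%g} by exact: gmulfM.
by rewrite -[n]mul1r -expgz_Z (morph_expgz psiM) (psi1 ord0) expgz_Z mul1r.
Qed.

Lemma Z_finitely_generated : finitely_generated int_group.
Proof.
exists [set (1 : int_group)]%classic; first exact: finite_set1.
apply/seteqP; split=> // n _ B [[B1 BF] /(_ 1 erefl) Bgen].
have BV y : B y -> B (- y) by move=> By; rewrite -[- y]add0r; apply: BF.
rewrite -[n]mul1r -expgz_Z.
elim: n => [|n IH|n IH]; first exact: B1.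
- have -> : n.+1%:Z = n%:Z + 1 by rewrite intS addrC.
  rewrite expgzS -[expgz _ _]opprK; exact/BF/BV.
- have -> : - n.+1%:Z = - n%:Z - 1 by rewrite intS opprD addrC.
  by rewrite expgzP int_group_mulC; exact: BF.
Qed.

Lemma Z_sela : sela_limit_group int_group.
Proof.
exists 1%N, int_group, int_group, (fun=> 1), (fun=> idfun), idfun; split.
- exact: Z_free.
- exact: Z_finitely_generated.
- move=> g; have [->|/eqP g1] := eqVneq g 1%g; [left|right]; exact: nearW.
- by move=> y _; exists y.
- apply/seteqP; split=> g /=; first by move=> g1; exact: nearW.
  by move=> /filter_ex[].
Qed.

(** The generator [d] is the least positive element. *)
Lemma Z_subgroup (H : set int_group) : is_subgroup H -> H <> [set 1%g]%classic ->
  exists2 d : int, d != 0 & H = [set d * n | n in [set: int]]%classic.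
Proof.
move=> [H1 HF] Hn1.
have HV x : H x -> H (- x) by move=> Hx; rewrite -[- x]add0r; apply: HF.
have HB x y : H x -> H y -> H (x - y) by exact: HF.
have HD x y : H x -> H y -> H (x + y).
  by move=> Hx Hy; rewrite -[y]opprK; apply/HB/HV.
have HM x n : H x -> H (x * n).
  move=> Hx; elim: n => [|n IH|n IH]; first by rewrite mulr0.
  - by rewrite intS mulrDr mulr1; exact: HD.
  - by rewrite intS opprD mulrDr mulrN1; apply: HD => //; exact: HV.
have exd : exists d : nat, (0 < d)%N && `[< H d%:Z >].
  apply: contrapT => nod; apply: Hn1; apply/seteqP; split=> [x Hx|_ ->] //.
  have [->//|x0] := eqVneq x 0; exfalso; apply: nod; exists `|x|%N.
  rewrite absz_gt0 x0; apply/asboolP.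
  by case: (intP x) Hx => [|m|m] //=; move/HV; rewrite opprK.
case: (ex_minnP exd) => d /andP[d0 /asboolP Hd] mind.
exists d%:Z; first by case: d d0 {Hd mind}.
apply/seteqP; split=> [x Hx|_ [n _ <-]]; last exact: HM.
exists (x %/ d%:Z)%Z => //; rewrite mulrC.
apply/eqP; rewrite -subr_eq0 -oppr_eq0 opprB; apply/eqP.
have -> : x - (x %/ d%:Z)%Z * d%:Z = (x %% d%:Z)%Z by [].
have Hr : H (x %% d%:Z)%Z by rewrite /modz mulrC; apply/HB/HM.
have dnz : d%:Z != 0 by case: d d0 {Hd mind Hr}.
have rge := modz_ge0 x dnz; have rlt := ltz_pmod x (d := d%:Z) d0.
case: (x %% d%:Z)%Z Hr rge rlt => // -[//|r] Hr _ rlt.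
have := mind r.+1; rewrite /= asboolT // => /(_ isT).
by move: rlt; rewrite ltz_nat ltnNge => /negP.
Qed.

Lemma Z_limit : limit_group int_group.
Proof.
split; first exact: Z_sela.
- by exists id; split=> // n _; exists n.
- move=> H [S _ HS] H1.
  have subH : is_subgroup H.
    rewrite HS; split=> [B [[]]|x y Hx Hy B BS] //.
    by have [[_ BF] _] := BS; apply: BF; [exact: Hx|exact: Hy].
  have [d d0 Hd] := Z_subgroup subH H1.
  exists (fun x : int => (x %/ d)%Z); rewrite Hd; split.
    move=> _ _ [m _ <-] [n _ <-]; rewrite -[(_ * _)%g]/(d * m + d * n).
    by rewrite -mulrDr !mulKz.
  by move=> n _; exists (d * n); [exists n|rewrite mulKz].
Qed.

(** In an abelian group the elements of the normal closure of [u] are the multiples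
of [u], and two nonzero integers that divide each other differ by a sign. *)
Lemma Z_magnus : magnus_property int_group.
Proof.
have Zconj (x g : int_group) : (x ^ g)%g = x by rewrite conjgE int_group_mulC mulgK.
have mul k n x : @normal_prod int_group k n x -> x = k * n.
  elim=> [|m y g _ ->|m y g _ ->]; first by rewrite mulr0.
  - by rewrite Zconj mulrDr mulr1.
  - by rewrite Zconj mulrDr mulrN1.
move=> u v /eq_normal_closureP[[m /mul uv] [n /mul vu]].
have [u0|u0] := eqVneq u 0.
  by left; exists 1%g; rewrite Zconj uv u0 mul0r.
have mn : m * n = 1.
  apply: (mulfI u0); rewrite mulr1 mulrA -uv. exact: esym.
have : (m == 1) || (m == -1).
  by have : m \is a GRing.unit; [apply/unitrP; exists n; rewrite [n * m]mulrC|].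
case/orP=> /eqP m1; [left|right]; exists 1%g; rewrite Zconj uv.
- by rewrite m1 mulr1.
- by rewrite -[RHS]/(- (u * m)) m1 mulrN1 opprK.
Qed.

(** * The equivalence *)

Theorem theorem1p2 (C : groupType) :
  (exists L : groupType,
      [/\ limit_group L, magnus_property L & magnus_property (L * C)%type])
  <->
  (forall (I : set nat) (L : I -> groupType),
      (forall i : I, limit_group (L i) /\ magnus_property (L i)) ->
      magnus_property (prodg L * C)%type).
Proof.
split=> [[L0 [[sL0 iL0 _] _ mLC]] I L HL|mprod].
  apply: magnus_prod mLC _; first exact: sela_exponent_rigid.
    exact: indicable_neq1.
  by move=> i; have [[sLi _ _] mLi] := HL i; split=> //; exact: sela_exponent_rigid.
(* The group of integers serves as [L]; [L * C] is the product over one index. *)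
exists int_group; split; [exact: Z_limit|exact: Z_magnus|].
have i0 : [set 0%N]%classic by exists 0%N; exact: mem_set.
apply: (@magnus_retract (prodg (fun _ : [set 0%N]%classic => int_group) * C)%type
  (int_group * C)%type (fun x => ((fun=> x.1), x.2)) (fun y => (y.1 i0, y.2))) => //.
  by case.
by apply: mprod => _; split; [exact: Z_limit|exact: Z_magnus].
Qed.
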